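(* Let $\mathcal{M}=\{m_1,\ldots,m_K\}$ be a finite set of $K$ elements, let $v:2^{\mathcal{M}}\to[0,1]$, and let $m_i,m_j\in\mathcal{M}$ be two distinct elements. Suppose there are a real number $\Delta>0$ and a real-valued function $u$ on the subsets of $\mathcal{M}\setminus\{m_i,m_j\}$ (so $u$ is independent of $m_i$ and $m_j$) such that for every $S\subseteq\mathcal{M}$, $$v(S)=u\bigl(S\setminus\{m_i,m_j\}\bigr)-\Delta\,\mathbf{1}\bigl[S\cap\{m_i,m_j\}\neq\emptyset\bigr].$$ Then the Leave-One-Out effects and the Shapley contributions of $m_i$ and $m_j$ satisfy $$d_i=d_j=0,\qquad \psi_i=\psi_j=-\frac{\Delta}{2}.$$
   Context: $\mathcal{M}$ is the set of retrieved memories (players) and $v:2^{\mathcal{M}}\to[0,1]$ is the task-value (characteristic) function of the cooperative game $(\mathcal{M},v)$. The (exact) Leave-One-Out effect of $m_k\in\mathcal{M}$ is $$d_k=v(\mathcal{M})-v(\mathcal{M}\setminus\{m_k\}).$$ The cooperative (Shapley) contribution of $m_k$ is $$\psi_k=\sum_{S\subseteq\mathcal{M}\setminus\{m_k\}}\frac{|S|!\,(K-|S|-1)!}{K!}\bigl[v(S\cup\{m_k\})-v(S)\bigr],$$ equivalently the average over all $K!$ orderings $\pi$ of $\mathcal{M}$ of $v(P_k(\pi)\cup\{m_k\})-v(P_k(\pi))$, where $P_k(\pi)$ is the set of elements preceding $m_k$ in $\pi$. $\mathbf{1}[\cdot]$ is the indicator (1 if the condition holds, 0 otherwise). *)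

(* Defs.v *)
From HB Require Import structures.
From mathcomp Require Import all_boot all_order all_algebra.
From mathcomp Require Import reals.

Set Implicit Arguments.
Unset Strict Implicit.
Unset Printing Implicit Defensive.

Import Order.TTheory GRing.Theory Num.Theory.
Local Open Scope ring_scope.

Definition loo_effect (R : realType) (M : finType) (v : {set M} -> R) (k : M)
    : R :=
  v [set: M] - v ([set: M] :\ k).

(* With K = #|M|.  Every S in the range omits k, so #|S| < K and the truncated
   subtraction on nat in the weight is exact. *)
Definition shapley (R : realType) (M : finType) (v : {set M} -> R) (k : M)
    : R :=
  \sum_(S : {set M} | S \subset [set: M] :\ k)
    (#|S|`! * (#|M| - #|S| - 1)`!)%:R / (#|M|`!)%:R * (v (k |: S) - v S).

(* Main.v *)
(* Adding i to a coalition S costs Delta when S omits j and costs nothing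
   otherwise.  Hence the Shapley value is -Delta times the total weight of the
   coalitions avoiding both i and j, i.e. the probability 1/2 that i precedes j
   in a random ordering. *)

Require Import Defs.
From HB Require Import structures.
From mathcomp Require Import all_boot all_order all_algebra.
From mathcomp Require Import reals.
From mathcomp Require Import ring.

Set Implicit Arguments.
Unset Strict Implicit.
Unset Printing Implicit Defensive.

Import Order.TTheory GRing.Theory Num.Theory.
Local Open Scope ring_scope.

(** Shapley weights depend on a coalition only through its size, so subsets are grouped by
    cardinality. [inord] loses nothing here, since [S \subset B] bounds the size by [#|B|]. *)
Lemma sum_subsets_card (T : finType) (B : {set T}) (f : nat -> nat) :
  (\sum_(S : {set T} | S \subset B) f #|S| =
   \sum_(k < #|B|.+1) 'C(#|B|, k) * f k)%N.
Proof.
rewrite (partition_big (fun S : {set T} => inord #|S| : 'I_#|B|.+1) xpredT) //=.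
apply: eq_bigr => k _.
rewrite -cards_draws -sum_nat_const.
apply: congr_big => // [S|S /andP[sSB /eqP <-]].
  rewrite inE; case sSB: (S \subset B) => //=.
  by rewrite -val_eqE /= inordK // ltnS subset_leq_card.
by rewrite inordK // ltnS subset_leq_card.
Qed.

(* Since 'C(n, k) * k! * (n + 1 - k)! = n! * (n + 1 - k), the sum is n! times a
   triangular number. *)
Lemma sum_shapley_weights (T : finType) (B : {set T}) :
  ((\sum_(S : {set T} | S \subset B) #|S|`! * (#|B|.+1 - #|S|)`!) * 2 =
   #|B|.+2`!)%N.
Proof.
rewrite (sum_subsets_card B (fun k => k`! * (#|B|.+1 - k)`!)%N).
set n := #|B|.
have -> : (\sum_(k < n.+1) 'C(n, k) * (k`! * (n.+1 - k)`!) =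
           n`! * \sum_(k < n.+1) (n.+1 - k))%N.
  rewrite big_distrr; apply: eq_bigr => k _ /=.
  have le_kn : (k <= n)%N by rewrite -ltnS.
  by rewrite subSn // factS -(bin_fact le_kn) [((_ - _).+1 * _)%N]mulnC !mulnA.
(* Reversing the index turns the summands into 1, ..., n + 1. *)
rewrite (reindex_inj rev_ord_inj) /=.
have -> : (\sum_(k < n.+1) (n.+1 - (n.+1 - k.+1)) = 'C(n.+2, 2))%N.
  rewrite -bin2_sum big_mkord [RHS]big_ord_recl add0n.
  by apply: eq_bigr => k _; rewrite subKn.
(* Absorption: 2 * 'C(n + 2, 2) = (n + 2) * 'C(n + 1, 1), which completes n! to (n + 2)!. *)
rewrite -mulnA [(_ * 2)%N]mulnC -mul_bin_diag bin1.
by rewrite mulnC [in RHS]factS [in RHS]factS mulnA.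
Qed.

(** The [u] terms cancel because [i] lies in the removed pair. The indicator is 1 once [i] has
    joined, and before that it is 1 exactly when [j] is in [S]. *)
Lemma marginal_substitute (R : realType) (M : finType) (v u : {set M} -> R)
    (i j : M) (Delta : R)
    (hvu : forall S : {set M},
       v S = u (S :\: [set i; j]) - Delta * (S :&: [set i; j] != set0)%:R)
    (S : {set M}) :
  i \notin S ->
  v (i |: S) - v S = - Delta * (j \notin S)%:R.
Proof.
move=> iS; rewrite !hvu.
have -> : (i |: S) :\: [set i; j] = S :\: [set i; j].
  by apply/setP => x; rewrite !inE; case: (x == i).
have -> : (i |: S) :&: [set i; j] != set0.
  by apply/set0Pn; exists i; rewrite !inE eqxx.
have -> : (S :&: [set i; j] != set0) = (j \in S).
  apply/set0Pn/idP => [[x]|jS]; last by exists j; rewrite !inE jS eqxx orbT.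
  by rewrite !inE => /andP[xS /orP[/eqP xi|/eqP <-//]]; rewrite -xi xS in iS.
by case: (j \in S) => /=; ring.
Qed.

(** This is the marginal of [i] over the complement of [i], which already contains [j]. *)
Lemma loo_substitute (R : realType) (M : finType) (v u : {set M} -> R)
    (i j : M) (Delta : R) (hij : i != j)
    (hvu : forall S : {set M},
       v S = u (S :\: [set i; j]) - Delta * (S :&: [set i; j] != set0)%:R) :
  loo_effect v i = 0.
Proof.
rewrite /loo_effect -{1}(setD1K (in_setT i)).
rewrite (marginal_substitute hvu) ?setD11 //.
by rewrite !inE eq_sym hij mulr0.
Qed.

Lemma shapley_substitute (R : realType) (M : finType) (v u : {set M} -> R)
    (i j : M) (Delta : R) (hij : i != j)
    (hvu : forall S : {set M},
       v S = u (S :\: [set i; j]) - Delta * (S :&: [set i; j] != set0)%:R) :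
  shapley v i = - (Delta / 2).
Proof.
pose B : {set M} := ~: [set i; j].
have cardM : #|M| = #|B|.+2 by rewrite -(cardsC [set i; j]) cards2 hij.
have subB (S : {set M}) :
  (S \subset B) = (S \subset [set: M] :\ i) && (j \notin S).
  by rewrite subsetD1 subsetT /B subsetC subUset !sub1set !inE.
rewrite /shapley.
transitivity (- Delta / (#|M|`!)%:R *
    (\sum_(S : {set M} | S \subset B) #|S|`! * (#|B|.+1 - #|S|)`!)%N%:R).
  rewrite natr_sum big_distrr /= (eq_bigl _ _ subB) big_mkcondr.
  apply: eq_bigr => S; rewrite subsetD1 => /andP[_ iS].
  (* Here K = [#|B|] + 2, so K - |S| - 1 becomes [#|B|.+1 - #|S|]. *)
  rewrite (marginal_substitute hvu) // subnAC cardM subn1 /=.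
  by case: (j \in S) => /=; rewrite ?mulr0 // mulr1 mulrC mulrA mulrAC.
(* With W the total weight, K! is replaced by 2W, and W cancels once it is nonzero, which follows
   from K! > 0. *)
have := congr1 (fun n => n%:R : R) (sum_shapley_weights B).
rewrite /= natrM -cardM => <-.
have w_neq0 : (\sum_(S : {set M} | S \subset B)
    #|S|`! * (#|B|.+1 - #|S|)`!)%N%:R != 0 :> R.
  rewrite pnatr_eq0; apply: contraTneq (fact_gt0 #|M|) => w0.
  by rewrite cardM -sum_shapley_weights w0.
by field.
Qed.

Theorem theorem1 (R : realType) (M : finType) (v : {set M} -> R)
    (hv : forall S : {set M}, 0 <= v S <= 1)
    (i j : M) (hij : i != j) (Delta : R) (hDelta : 0 < Delta)
    (u : {set M} -> R)
    (hvu : forall S : {set M},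
       v S = u (S :\: [set i; j])
             - Delta * (S :&: [set i; j] != set0)%:R) :
  [/\ loo_effect v i = 0, loo_effect v j = 0,
      shapley v i = - (Delta / 2) & shapley v j = - (Delta / 2)].
Proof.
(* The hypothesis is symmetric in [i] and [j], so the claims for [j] follow by swapping them. *)
have hvu' S : v S = u (S :\: [set j; i])
                    - Delta * (S :&: [set j; i] != set0)%:R.
  by rewrite [[set j; i]]setUC.
have hji : j != i by rewrite eq_sym.
by split; [ exact: loo_substitute hij hvu | exact: loo_substitute hji hvu'
          | exact: shapley_substitute hij hvu
          | exact: shapley_substitute hji hvu' ].
Qed.
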